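(* Let $n\geq 4$ and $0 \leq M \leq n-4$ be integers. Let $A \subseteq \mathbb{R}_{>0}$ be an $n$-element set. Then $$|\mathrm{FS}(A)| \leq \binom{n+1}{2}+1+M$$ if and only if there is some real $a>0$ such that $A \subseteq a\cdot \mathbb{Z}_{>0}$ and $$\sum_{x \in a^{-1} \cdot A} x \leq \binom{n+1}{2}+M.$$
   Context: For a finite subset $A$ of an abelian group, $\mathrm{FS}(A):=\{\sum_{x\in B}x : B\subseteq A\}$ is the set of subset sums of $A$ (the empty subset gives $0$). For a nonzero real $c$ and a set $X$ of reals, $c\cdot X:=\{cx: x\in X\}$. *)

(* Defs.v *)
From mathcomp Require Import all_boot all_order all_algebra finmap.
From mathcomp Require Import all_classical all_reals.

Set Implicit Arguments.
Unset Strict Implicit.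
Unset Printing Implicit Defensive.

Import Order.TTheory GRing.Theory Num.Theory.

Local Open Scope fset_scope.
Local Open Scope classical_set_scope.
Local Open Scope ring_scope.

Definition FS (V : zmodType) (A : {fset V}) : {fset V} :=
  [fset \sum_(x <- B) x | B : {fset V} in fpowerset A].

Definition dilate (R : realType) (c : R) (X : set R) : set R :=
  [set c * x | x in X].

Definition posint (R : realType) : set R :=
  [set k%:~R | k in [set k : int | 0 < k]].
Arguments posint R : clear implicits.

(* Main.v *)
Require Import Defs.
From mathcomp Require Import all_boot all_order all_algebra finmap.
From mathcomp Require Import all_classical all_reals.
From mathcomp Require Import zify lra.

Set Implicit Arguments.
Unset Strict Implicit.
Unset Printing Implicit Defensive.

Import Order.TTheory GRing.Theory Num.Theory.

Local Open Scope fset_scope.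
Local Open Scope classical_set_scope.
Local Open Scope ring_scope.

(** The easy direction: if the elements of [A] are positive multiples of [a]
    and add up to at most [a *+ K], then every subset sum is one of the
    [K + 1] numbers [0, a, ..., a *+ K].

    For the converse it is enough to find [a > 0] such that the subset sums
    are exactly [0, a, ..., a *+ N]: then [N] is the number of sums minus one
    and the total of [A] is [a *+ N].  This is the form proved by induction,
    removing the largest element [m] of [m |` A].  Let [S] be the total of
    [m |` A].  The complements [S - s], for [s] equal to [0] or to an element
    of [A], exceed the total [S - m] of [A], hence they are [#|` A|.+1] subset
    sums of [m |` A] that are not subset sums of [A] ([FS_gain]).  Adding
    these gains up gives the general lower bound [card_FS_ge].

    If [m] brings more than that minimal gain, then [A] is closer to
    the lower bound than [m |` A] was, so the induction hypothesis applies to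
    it with [M - 1] and [FS A] is [0, a, ..., a *+ N].  Either [m] is one of
    these numbers, and then the sums of [m |` A] fill a longer progression of
    the same kind, or the translate of [FS A] by [m] is disjoint from [FS A],
    which doubles the number of sums and exceeds the assumed bound.

    If the gain is minimal, every new sum is one of the complements above.
    Read through the symmetry [s |-> S - s], this makes [FS A] periodic
    downwards with period [m], and makes [0] and the elements of [A] its only
    members below [m] ([FS_tight]).  So [0 |` A] behaves like a subset of the
    circle of length [m] that is closed under sums of distinct elements, and
    this forces the shape [d, 2d, ..., nd] ([tight_chain]), for which the
    subset sums fill a progression ([FS_chain]).  With four elements and
    [M = 0] the gain has to be minimal by the lower bound, so the induction
    needs no separate base case. *)

(** * Subset sums *)

Lemma FSP (V : zmodType) (A : {fset V}) (s : V) :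
  reflect (exists2 B : {fset V}, (B `<=` A)%fset & s = \sum_(x <- B) x)
          (s \in FS A).
Proof.
apply: (iffP (imfsetP _ _ _ _)) => -[B /= BA ->]; exists B => //.
  by rewrite -fpowersetE.
by rewrite fpowersetE.
Qed.

Lemma in_FSU1 (V : zmodType) (A : {fset V}) (a s : V) : a \notin A ->
  (s \in FS (a |` A)%fset) = (s \in FS A) || (s - a \in FS A).
Proof.
move=> aA; apply/FSP/orP => [[B BaA ->]|[/FSP[B BA ->]|/FSP[B BA sE]]].
- have [aB|aB] := boolP (a \in B).
    right; apply/FSP; exists (B `\ a)%fset; first by rewrite fsubDset.
    by rewrite (big_fsetD1 a aB) /= addrC addrK.
  left; apply/FSP; exists B => //; apply/fsubsetP => x xB.
  have /fset1UP[xa|//] := fsubsetP BaA x xB.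
  by rewrite -xa xB in aB.
- by exists B => //; apply: fsubset_trans BA (fsubsetU1 _ _).
- exists (a |` B)%fset; first exact: fsetUS.
  have aB : a \notin B by apply: contra aA; apply: fsubsetP.
  by rewrite big_fsetU1 //= -sE addrC subrK.
Qed.

Lemma FS0 (V : zmodType) : FS (fset0 : {fset V}) = [fset 0]%fset.
Proof.
apply/fsetP => s; rewrite inE; apply/FSP/eqP => [[B]|->].
  by rewrite fsubset0 => /eqP -> ->; rewrite big_seq_fset0.
by exists fset0; rewrite ?fsub0set ?big_seq_fset0.
Qed.

Lemma FS_sub (V : zmodType) (A B : {fset V}) (s : V) :
  (A `<=` B)%fset -> s \in FS A -> s \in FS B.
Proof.
by move=> AB /FSP[C CA ->]; apply/FSP; exists C => //; apply: fsubset_trans AB.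
Qed.

Lemma FS_0 (V : zmodType) (A : {fset V}) : 0 \in FS A.
Proof. by apply: (FS_sub (fsub0set A)); rewrite FS0 inE. Qed.

Lemma FS_mem (V : zmodType) (A : {fset V}) (x : V) : x \in A -> x \in FS A.
Proof.
by move=> xA; apply/FSP; exists [fset x]%fset; rewrite ?fsub1set ?big_seq_fset1.
Qed.

Lemma FS_add (V : zmodType) (A : {fset V}) (x y : V) :
  x \in A -> y \in A -> x != y -> x + y \in FS A.
Proof.
move=> xA yA xy; apply/FSP; exists [fset x; y]%fset.
  by apply/fsubsetP => z /fset2P[] ->.
by rewrite big_fsetU1 ?big_seq_fset1 ?inE.
Qed.

(** Complementation of subsets makes the set of subset sums symmetric about
    half the total; this is what turns the large sums into small ones below. *)
Lemma FS_compl (V : zmodType) (A : {fset V}) (s : V) :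
  s \in FS A -> \sum_(x <- A) x - s \in FS A.
Proof.
case/FSP=> B BA ->; apply/FSP; exists (A `\` B)%fset; first exact: fsubsetDl.
rewrite (big_fsetID _ [in B]) /= addrC.
have -> : [fset x in A | x \in B]%fset = B.
  by apply/fsetP => x; rewrite !inE andb_idl //; apply: fsubsetP.
have -> : [fset x in A | x \notin B]%fset = (A `\` B)%fset.
  by apply/fsetP => x; rewrite !inE andbC.
by rewrite addrK.
Qed.

Lemma FS_total (V : zmodType) (A : {fset V}) : \sum_(x <- A) x \in FS A.
Proof. by rewrite -[X in X \in _]subr0; apply/FS_compl/FS_0. Qed.

Lemma FS_ge0 (R : realDomainType) (A : {fset R}) (s : R) :
  (forall x, x \in A -> 0 < x) -> s \in FS A -> 0 <= s.
Proof.
move=> Apos /FSP[B BA ->]; rewrite big_seq; apply: sumr_ge0 => x xB.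
exact/ltW/Apos/(fsubsetP BA).
Qed.

Lemma FS_le_total (R : realDomainType) (A : {fset R}) (s : R) :
  (forall x, x \in A -> 0 < x) -> s \in FS A -> s <= \sum_(x <- A) x.
Proof. by move=> Apos /FS_compl/(FS_ge0 Apos); rewrite subr_ge0. Qed.

(** * Finite sets of an ordered ring *)

Lemma fset_max (R : realDomainType) (A : {fset R}) : A != fset0 ->
  exists2 m, m \in A & forall x, x \in A -> x <= m.
Proof.
case/fset0Pn=> x0 x0A.
case: (@Order.TotalTheory.arg_maxP _ _ A [` x0A]%fset xpredT val isT)
  => m _ mmax.
by exists (val m) => [|x xA]; [exact: valP | exact: (mmax [` xA]%fset isT)].
Qed.

Lemma fset_min (R : realDomainType) (A : {fset R}) : A != fset0 ->
  exists2 m, m \in A & forall x, x \in A -> m <= x.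
Proof.
case/fset0Pn=> x0 x0A.
case: (@Order.TotalTheory.arg_minP _ _ A [` x0A]%fset xpredT val isT)
  => m _ mmin.
by exists (val m) => [|x xA]; [exact: valP | exact: (mmin [` xA]%fset isT)].
Qed.

(** What a new element contributes to the subset sums is under control only if
    it exceeds all the previous ones, so the inductions below build [A] in
    increasing order. *)
Lemma fset_max_ind (R : realDomainType) (P : {fset R} -> Prop) :
  P fset0 ->
  (forall (A : {fset R}) m, (forall x, x \in A -> x < m) -> P A ->
     P (m |` A)%fset) ->
  forall A, P A.
Proof.
move=> P0 PU A; have [n] := ubnP #|` A|; elim: n A => // n IHn A ltAn.
have [->//|/fset_max[m mA mmax]] := eqVneq A fset0.
rewrite -(fsetD1K mA); apply: PU => [x|].
  by case/fsetD1P=> xm xA; rewrite lt_neqAle xm mmax.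
by apply: IHn; rewrite (cardfsD1 m A) mA in ltAn.
Qed.

Lemma card_fsetU1_max (R : realDomainType) (A : {fset R}) (m : R) :
  (forall x, x \in A -> x < m) -> #|` m |` A|%fset = #|` A|.+1.
Proof.
move=> Am; rewrite cardfsU1; case: (boolP (m \in A)) => // /Am.
by rewrite ltxx.
Qed.

(** * Subset sums that fill a progression *)

Definition multiples (V : zmodType) (a : V) (N : nat) : {fset V} :=
  [fset a *+ val k | k in 'I_N.+1]%fset.

Lemma multiplesP (V : zmodType) (a : V) (N : nat) (s : V) :
  reflect (exists2 k, (k <= N)%N & s = a *+ k) (s \in multiples a N).
Proof.
apply: (iffP (imfsetP _ _ _ _)) => [[k _ ->]|[k kN ->]].
  by exists k; rewrite // -ltnS ltn_ord.
by exists (Ordinal (kN : k < N.+1)%N).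
Qed.

Lemma card_multiples (R : realDomainType) (a : R) (N : nat) : 0 < a ->
  #|` multiples a N| = N.+1.
Proof.
move=> a0; rewrite card_imfset /=; last first.
  by move=> i j /(mulrIn (lt0r_neq0 a0))/val_inj.
by rewrite -cardE card_ord.
Qed.

(** As [k <= N.+1], the translate of [0, ..., N] by [k] starts before or right
    after the end of [0, ..., N], so their union has no hole. *)
Lemma FS_multiplesU1 (V : zmodType) (A : {fset V}) (a : V) (N k : nat) :
  a *+ k \notin A -> (k <= N.+1)%N -> FS A = multiples a N ->
  FS (a *+ k |` A)%fset = multiples a (N + k).
Proof.
move=> kA kN FSA; apply/fsetP => s; rewrite in_FSU1 // FSA.
apply/orP/multiplesP.
  case=> /multiplesP[j jN sE]; first by exists j; [lia | ].
  by exists (j + k)%N; [lia | rewrite mulrnDr -sE subrK].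
case=> j jNk ->.
have [jN|Nj] := leqP j N; first by left; apply/multiplesP; exists j.
by right; apply/multiplesP; exists (j - k)%N; [lia | rewrite mulrnBr //; lia].
Qed.

(** The hypothesis says that [A] is [d, 2d, ..., nd], in a form that survives
    the removal of the maximum.  The maximum [m] is [d] or [d] more than a
    smaller element of [A], so it does not jump over the progression built so
    far. *)
Lemma FS_chain (R : realDomainType) (d : R) (A : {fset R}) : 0 < d ->
  (forall x, x \in A -> x != d -> x - d \in A) ->
  exists N, FS A = multiples d N.
Proof.
move=> d0; elim/fset_max_ind: A => [_|A m Am IH step].
  exists 0%N; rewrite FS0; apply/fsetP => s; rewrite inE.
  apply/eqP/multiplesP => [->|[k]]; first by exists 0%N.
  by rewrite leqn0 => /eqP -> ->.
have mA : m \notin A by apply/negP => /Am; rewrite ltxx.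
have [|N FSA] := IH.
  move=> x xA xd; have /fset1UP[xdm|//] := step x (fset1Ur _ xA) xd.
  by exfalso; have := Am x xA; lra.
have [k kN mE] : exists2 k, (k <= N)%N & m - d = d *+ k.
  apply/multiplesP; rewrite -FSA.
  have [->|md] := eqVneq m d; first by rewrite subrr FS_0.
  have /fset1UP[|/FS_mem//] := step m (fset1U1 _ _) md.
  by move/eqP; rewrite -subr_eq0 addrAC subrr sub0r oppr_eq0 gt_eqF.
have {}mE : m = d *+ k.+1 by rewrite mulrSr -mE subrK.
by exists (N + k.+1)%N; rewrite mE in mA *; apply: FS_multiplesU1.
Qed.

(** * Sums gained by adding a new maximum *)

(** The sums that leave out at most one element of [A]. *)
Definition cosums (V : zmodType) (m : V) (A : {fset V}) : {fset V} :=
  [fset \sum_(x <- m |` A) x - s | s in (0 |` A)]%fset.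

(** Leaving out one element of [A] loses less than [m], so these sums stay above
    the total of [A]. *)
Lemma cosums_sub (R : realDomainType) (m : R) (A : {fset R}) :
  0 < m -> (forall x, x \in A -> 0 < x < m) ->
  (cosums m A `<=` FS (m |` A) `\` FS A)%fset.
Proof.
move=> m0 Am; have Apos x : x \in A -> 0 < x by case/Am/andP.
have mA : m \notin A by apply/negP => /Am; rewrite ltxx andbF.
apply/fsubsetP => _ /imfsetP[s /= sA ->]; rewrite inE; apply/andP; split.
  apply/negP => /(FS_le_total Apos); rewrite big_fsetU1 //=.
  by case/fset1UP: sA => [->|/Am/andP[_]]; lra.
apply: FS_compl; case/fset1UP: sA => [->|sA]; first exact: FS_0.
by apply: FS_mem; apply: fset1Ur.
Qed.

Lemma card_cosums (R : realDomainType) (m : R) (A : {fset R}) :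
  (forall x, x \in A -> 0 < x) -> #|` cosums m A| = #|` A|.+1.
Proof.
move=> Apos; rewrite card_imfset /=; last by move=> s t /addrI/oppr_inj.
by rewrite cardfsU1; case: (boolP (0 \in A)) => // /Apos; rewrite ltxx.
Qed.

Lemma card_FSU1 (R : realDomainType) (m : R) (A : {fset R}) :
  m \notin A ->
  (#|` FS (m |` A)%fset| = #|` FS A| + #|` (FS (m |` A) `\` FS A)%fset|)%N.
Proof.
move=> mA; have sub : (FS A `<=` FS (m |` A)%fset)%fset.
  by apply/fsubsetP => s; apply/FS_sub/fsubsetU1.
by rewrite cardfsDS // subnKC // fsubset_leq_card.
Qed.

Lemma FS_gain (R : realDomainType) (m : R) (A : {fset R}) :
  0 < m -> (forall x, x \in A -> 0 < x < m) ->
  (#|` FS A| + #|` A|.+1 <= #|` FS (m |` A)%fset|)%N.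
Proof.
move=> m0 Am; have Apos x : x \in A -> 0 < x by case/Am/andP.
have mA : m \notin A by apply/negP => /Am; rewrite ltxx andbF.
rewrite card_FSU1 // leq_add2l -(card_cosums m Apos).
by apply/fsubset_leq_card/cosums_sub.
Qed.

Lemma bin2S (k : nat) : 'C(k.+1 + 1, 2) = ('C(k + 1, 2) + k.+1)%N.
Proof. by rewrite !addn1 binS bin1. Qed.

(** Summing the gains [1, 2, ..., n] along the increasing order of [A]. *)
Lemma card_FS_ge (R : realDomainType) (A : {fset R}) :
  (forall x, x \in A -> 0 < x) -> ('C(#|` A| + 1, 2) + 1 <= #|` FS A|)%N.
Proof.
elim/fset_max_ind: A => [_|A m Am IH pos]; first by rewrite FS0 cardfs0 cardfs1.
have Apos x : x \in A -> 0 < x by move=> xA; apply/pos/fset1Ur.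
have Abnd x : x \in A -> 0 < x < m by move=> xA; rewrite Apos // Am.
have := FS_gain (pos _ (fset1U1 _ _)) Abnd.
have := IH Apos; rewrite (card_fsetU1_max Am).
by rewrite bin2S addnAC -(leq_add2r #|` A|.+1) => h1 /(leq_trans h1).
Qed.

(** With minimal gain, [cosums m A] is all of what is new.  Let [S] be the
    total of [m |` A].  For a sum [s] of [A], the complement [S - s] is then
    either new, hence [s] is [0] or in [A], or a sum of [A], and its complement
    in [A] is [s - m].  The second case is impossible when [s < m], the first
    when [m <= s]. *)
Lemma FS_tight (R : realDomainType) (m : R) (A : {fset R}) :
  0 < m -> (forall x, x \in A -> 0 < x < m) ->
  (#|` FS (m |` A)%fset| <= #|` FS A| + #|` A|.+1)%N ->
  forall s, s \in FS A ->
    if s < m then s \in (0 |` A)%fset else s - m \in FS A.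
Proof.
move=> m0 Am; have Apos x : x \in A -> 0 < x by case/Am/andP.
have mA : m \notin A by apply/negP => /Am; rewrite ltxx andbF.
rewrite card_FSU1 // leq_add2l -(card_cosums m Apos) => tight.
have newE : cosums m A = (FS (m |` A) `\` FS A)%fset.
  by apply/eqP; rewrite eqEfcard cosums_sub.
have small s : s \in FS A -> \sum_(x <- A) x + m - s \notin FS A ->
    s \in (0 |` A)%fset.
  move=> sA nS.
  have : \sum_(x <- (m |` A)%fset) x - s \in cosums m A.
    rewrite newE in_fsetD FS_compl ?andbT.
      by rewrite big_fsetU1 //= [m + _]addrC.
    exact: FS_sub (fsubsetU1 _ _) sA.
  by case/imfsetP => t /= tA /addrI/oppr_inj ->.
move=> s sA; have [sm|ms] := ltP s m.
  apply: small => //; apply/negP => /(FS_le_total Apos).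
  by rewrite -addrA gerDl subr_le0 leNgt sm.
have [S|nS] := boolP (\sum_(x <- A) x + m - s \in FS A).
  suff -> : s - m = \sum_(x <- A) x - (\sum_(x <- A) x + m - s).
    exact: FS_compl.
  by rewrite -addrA opprD addNKr opprB.
have /fset1UP[s0|/Am/andP[_]] := small s sA nS; last by rewrite ltNge ms.
by move: m0; rewrite ltNge -s0 ms.
Qed.

(** Let [d < t] be the extreme elements of [A].  By [FS_tight], a sum of two
    distinct elements of [A] is in [A] if it is below [m]; otherwise, reduced
    by [m], it is [0] or in [A].  As [t + d] is too large for [A], while
    [t + d - m] is smaller than [d], this gives [t + d = m].  Thus adding [t]
    is subtracting [d] modulo [m], which shows that [A] is stable under [d]
    steps down; only the step from [t] itself, where [t + t] is not a sum of
    distinct elements, needs another argument. *)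
Lemma tight_chain (R : realDomainType) (m : R) (A : {fset R}) :
  (3 <= #|` A|)%N -> 0 < m -> (forall x, x \in A -> 0 < x < m) ->
  (#|` FS (m |` A)%fset| <= #|` FS A| + #|` A|.+1)%N ->
  exists2 d, 0 < d &
    forall x, x \in (m |` A)%fset -> x != d -> x - d \in (m |` A)%fset.
Proof.
move=> A3 m0 Am /(FS_tight m0 Am) tight.
have A0 : A != fset0 by rewrite -cardfs_gt0; lia.
have [d dA dmin] := fset_min A0; have [t tA tmax] := fset_max A0.
have B0 : (A `\ t `\ d)%fset != fset0.
  move: A3; rewrite -cardfs_gt0 (cardfsD1 t A) tA (cardfsD1 d (A `\ t)%fset).
  by case: (d \in _) => /=; case: #|` _|.
have [u /fsetD1P[ud /fsetD1P[ut uA]] umax] := fset_max B0.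
have d0 : 0 < d by case/andP: (Am d dA).
have Apos x : x \in A -> 0 < x by case/Am/andP.
have dt : d < t.
  by apply: lt_le_trans (tmax u uA); rewrite lt_neqAle eq_sym ud dmin.
have dm : d < m by case/andP: (Am d dA).
have tm : t < m by case/andP: (Am t tA).
have tdm : t + d = m.
  have := tight _ (FS_add tA dA (negbT (gt_eqF dt))).
  have [_|_ /tight] := ltP (t + d) m.
    case/fset1UP=> [/eqP|/tmax]; first by rewrite gt_eqF // addr_gt0 ?Apos.
    by rewrite gerDl leNgt d0.
  rewrite ifT; last by rewrite ltrBlDr ltrD.
  case/fset1UP=> [/eqP|/dmin]; first by rewrite subr_eq0 => /eqP.
  by rewrite addrAC lerDr subr_ge0 leNgt tm.
have utt : u <= t := tmax u uA.
have utd : t - d = u.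
  (* [u + d] is a sum below [t + d = m], so it is in [A], above the second
     largest element [u]: it can only be [t]. *)
  have utlt : u < t by rewrite lt_neqAle ut utt.
  have := tight _ (FS_add uA dA ud).
  rewrite ifT; last by rewrite -tdm ltrD2r.
  case/fset1UP=> [/eqP|udA]; first by rewrite gt_eqF // addr_gt0 ?Apos.
  have [<-|udt] := eqVneq (u + d) t; first by rewrite addrK.
  have : u + d <= u.
    by apply: umax; rewrite !inE udt udA andbT gt_eqF // ltrDr Apos.
  by rewrite gerDl leNgt d0.
exists d => // x /fset1UP[->|xA] xd.
  by apply: fset1Ur; rewrite -tdm addrK.
apply: fset1Ur; have [->|xt] := eqVneq x t; first by rewrite utd.
have dx := dmin x xA; have xm : x < m by case/andP: (Am x xA).
have := tight _ (FS_add xA tA xt).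
rewrite ltNge -tdm addrKA [t + d]addrC lerD2r dx /=.
move/tight; rewrite ifT; last by apply: lt_trans xm; rewrite ltrBlDr ltrDl.
by case/fset1UP => // /eqP; rewrite subr_eq0 (negbTE xd).
Qed.

(** A common value of [FS A] and its translate by [m] would exhibit [m] as a
    difference of two multiples of [a] up to [a *+ N], hence as one itself. *)
Lemma FS_doubles (R : realDomainType) (m a : R) (N : nat) (A : {fset R}) :
  0 < a -> 0 < m -> m \notin A -> FS A = multiples a N ->
  m \notin multiples a N ->
  (#|` FS A| + #|` FS A| <= #|` FS (m |` A)%fset|)%N.
Proof.
move=> a0 m0 mA FSA mN; rewrite card_FSU1 // leq_add2l.
have -> : #|` FS A| = #|` [fset (s + m)%R | s in FS A]%fset|.
  by rewrite [RHS]card_imfset //= => s t /addIr.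
apply/fsubset_leq_card/fsubsetP => _ /imfsetP[s /= sA ->].
rewrite in_fsetD in_FSU1 // addrK sA orbT andbT.
apply: contra mN; move: sA; rewrite FSA.
case/multiplesP=> i iN -> /multiplesP[j jN jE].
have mE : m = a *+ j - a *+ i by rewrite -jE addrC addKr.
have ij : (i < j)%N.
  by rewrite -(ltr_pMn2l a0) -subr_gt0 -mE.
by apply/multiplesP; exists (j - i)%N; [lia | rewrite mE mulrnBr 1?ltnW].
Qed.

(** * The inverse theorem *)

(** The conclusion describes [FS A] instead of [A], since what the induction
    step has to know is how [FS A] meets its translate by the new maximum. *)
Lemma FS_inverse (R : realDomainType) (M : nat) (A : {fset R}) :
  (forall x, x \in A -> 0 < x) -> (4 <= #|` A|)%N -> (M <= #|` A| - 4)%N ->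
  (#|` FS A| <= 'C(#|` A| + 1, 2) + 1 + M)%N ->
  exists a N, 0 < a /\ FS A = multiples a N.
Proof.
elim/fset_max_ind: A M => [|A m Am IH] M; first by rewrite cardfs0.
move=> pos; have m0 : 0 < m by apply/pos/fset1U1.
have Apos x : x \in A -> 0 < x by move=> xA; apply/pos/fset1Ur.
have Abnd x : x \in A -> 0 < x < m by move=> xA; rewrite Apos // Am.
have mA : m \notin A by apply/negP => /Am; rewrite ltxx.
rewrite (card_fsetU1_max Am) bin2S => A4 MA cardM.
have [tight|gain] := leqP #|` FS (m |` A)%fset| (#|` FS A| + #|` A|.+1)%N.
  have [//|d d0 chain] := tight_chain _ m0 Abnd tight.
  by have [N FSN] := FS_chain d0 chain; exists d, N.
(* A gain above the minimum leaves [A] with excess at most [M - 1]; as no set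
   lies below the lower bound, this also gives [0 < M], whence [4 <= #|` A|].
   Both sides of [M <= n - 4] decrease by one. *)
have ge := card_FS_ge Apos.
have cardA : (#|` FS A| < 'C(#|` A| + 1, 2) + 1 + M)%N.
  rewrite -(ltn_add2r #|` A|.+1); apply: leq_trans gain (leq_trans cardM _).
  by lia.
have M0 : (0 < M)%N.
  by rewrite -(ltn_add2l ('C(#|` A| + 1, 2) + 1)) addn0 (leq_ltn_trans ge).
have [a [N [a0 FSA]]] : exists a N, 0 < a /\ FS A = multiples a N.
  by apply: (IH M.-1) => //; [lia | lia | rewrite -ltnS -addnS prednK].
have [/multiplesP[k kN mE]|mN] := boolP (m \in multiples a N).
  exists a, (N + k)%N; split=> //; rewrite mE in mA *.
  by apply: FS_multiplesU1; rewrite // leqW.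
(* [m] off the progression: twice the lower bound for [FS A] exceeds the
   assumed upper bound for [FS (m |` A)]. *)
have := leq_trans (FS_doubles a0 m0 mA FSA mN) cardM.
move/(leq_trans (leq_add ge ge)); case: #|` A| A4 MA => [|[|p]] // _.
by rewrite !bin2S; lia.
Qed.

(** * Multiples and dilates *)

Lemma sum_dilate (R : realType) (c : R) (A : {fset R}) : c != 0 ->
  \sum_(x \in dilate c [set` A]) x = c * \sum_(x <- A) x.
Proof.
move=> c0; rewrite /dilate fsbig_image; last by move=> x y _ _; apply: mulfI.
by rewrite -fsbig_seq ?fset_uniq // mulr_sumr.
Qed.

Lemma dilate_posintP (R : realType) (a x : R) :
  dilate a (posint R) x <-> exists2 k, (0 < k)%N & x = a *+ k.
Proof.
split=> [[_ [[k|//] /= k0 <-] <-]|[k k0 ->]].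
  by exists k; rewrite ?mulr_natr.
by exists k%:R; rewrite ?mulr_natr //; exists k%:Z.
Qed.

Lemma FS_in_multiples (R : realDomainType) (a : R) (K : nat) (A : {fset R}) :
  0 < a -> (forall x, x \in A -> exists2 k, (0 < k)%N & x = a *+ k) ->
  \sum_(x <- A) x <= a *+ K -> (FS A `<=` multiples a K)%fset.
Proof.
move=> a0 Aa SK; apply/fsubsetP => s sA.
have Apos x : x \in A -> 0 < x by case/Aa => k k0 ->; rewrite pmulrn_lgt0.
have sK : s <= a *+ K := le_trans (FS_le_total Apos sA) SK.
have [k sE] : exists k, s = a *+ k.
  case/FSP: sA => B /fsubsetP BA ->; rewrite big_seq.
  elim/big_ind: _ => [|_ _ [i ->] [j ->]|x /BA/Aa[k _ ->]]; last by exists k.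
    by exists 0%N.
  by exists (i + j)%N; rewrite mulrnDr.
apply/multiplesP; exists k => //.
by rewrite -(ler_pMn2l a0) -sE.
Qed.

(** * The theorem *)

Theorem theorem1p1 (R : realType) (n M : nat) (hn : (4 <= n)%N)
    (hM : (M <= n - 4)%N) (A : {fset R}) (hApos : forall x, x \in A -> 0 < x)
    (hAn : #|` A| = n) :
  (#|` FS A| <= 'C(n + 1, 2) + 1 + M)%N <->
  exists a : R, [/\ 0 < a, [set` A] `<=` dilate a (posint R) &
    \sum_(x \in dilate a^-1 [set` A]) x <= ('C(n + 1, 2) + M)%N%:R].
Proof.
subst n; split=> [FSM|[a [a0 Aa]]].
  have [a [N [a0 FSA]]] := FS_inverse hApos hn hM FSM.
  move: FSM; rewrite FSA card_multiples // => NM.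
  exists a; split=> //.
    move=> x xA; apply/dilate_posintP.
    have /multiplesP[[|k] kN xE] : x \in multiples a N by rewrite -FSA FS_mem.
      by have := hApos x xA; rewrite xE ltxx.
    by exists k.+1.
  rewrite sum_dilate ?invr_eq0 ?lt0r_neq0 //.
  have /multiplesP[k kN ->] : \sum_(x <- A) x \in multiples a N.
    by rewrite -FSA FS_total.
  rewrite -[a *+ k]mulr_natr mulKf ?lt0r_neq0 // ler_nat.
  by apply: leq_trans kN _; lia.
rewrite sum_dilate ?invr_eq0 ?lt0r_neq0 // ler_pdivrMl // mulr_natr => SA.
have FSsub := FS_in_multiples a0
  (fun x xA => (dilate_posintP a x).1 (Aa x xA)) SA.
apply: leq_trans (fsubset_leq_card FSsub) _.
by rewrite card_multiples // -addn1 addnAC.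
Qed.
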